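(* Let $\mathbb{K}$ be an algebraically closed field, let $A$ be a $\mathbb{K}$-algebra, let $\alpha$ be a $\mathbb{K}$-automorphism of $A$ and let $v\in A$ be central. Let $R=R(A,\alpha,v,1)$ be the ambiskew polynomial ring and suppose that it is conformal, with splitting element $u$ (so $u\in A$ is central and $v=u-\alpha(u)$) and corresponding Casimir element $z=xy-u$, which is central in $R$. Let $\mathcal{Z}$ be the multiplicatively closed set of central elements $\mathbb{K}[z]\setminus\{0\}$. Suppose that the skew Laurent polynomial ring $A[y^{\pm 1};\alpha]$ is simple and that its centre is $Z(A[y^{\pm 1};\alpha])=\mathbb{K}$. Then the localization $R_{\mathcal{Z}}$ is simple if and only if, for all $m\geq 1$, there exists a non-zero polynomial $p_m(X)\in \mathbb{K}[X]$ such that $p_m(u)\in v^{(m)}A$, where $v^{(m)}=\sum_{l=0}^{m-1}\alpha^{l}(v)=u-\alpha^m(u)$.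
   Context: Rings are associative with $1$. For a $\mathbb{K}$-algebra $A$, a $\mathbb{K}$-automorphism $\alpha$ of $A$ and a central element $v\in A$, the ambiskew polynomial algebra $R(A,\alpha,v,1)$ is the iterated skew polynomial ring $A[y;\alpha][x;\beta,\delta]$, where $\beta=\alpha^{-1}$ on $A$, $\beta(y)=y$, and $\delta$ is the $\beta$-derivation of $A[y;\alpha]$ with $\delta(A)=0$ and $\delta(y)=v$. Thus $ya=\alpha(a)y$ and $xa=\alpha^{-1}(a)x$ for all $a\in A$, and $xy=yx+v$. It is conformal if there is a central element $u\in A$ (a splitting element) with $v=u-\alpha(u)$; then the Casimir element $z=xy-u=yx-\alpha(u)$ is central in $R$. The ring $A[y^{\pm 1};\alpha]$ is the skew Laurent polynomial ring with $ya=\alpha(a)y$. *)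

(* Defs.v *)
From HB Require Import structures.
From mathcomp Require Import all_boot all_algebra.

Set Implicit Arguments.
Unset Strict Implicit.
Unset Printing Implicit Defensive.

Import GRing.Theory.
Local Open Scope ring_scope.

Definition central (R : pzRingType) (c : R) : Prop := forall r : R, c * r = r * c.

Definition two_sided_ideal (R : pzRingType) (I : R -> Prop) : Prop :=
  [/\ I 0,
      forall a b, I a -> I b -> I (a + b),
      forall r a, I a -> I (r * a) &
      forall a r, I a -> I (a * r)].

(* The only two-sided ideals are 0 and the whole ring.  Ideals are Prop-valued,
   so no decidability of membership is assumed. *)
Definition simple_ring (R : pzRingType) : Prop :=
  (1 : R) <> 0 /\
  forall I : R -> Prop, two_sided_ideal I ->
    (forall a, I a -> a = 0) \/ (forall a, I a).

(* S, made a left A-module through i, is free with basis the family e. *)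
Definition left_basis (A S : pzRingType) (i : A -> S) (J : eqType) (e : J -> S)
    : Prop :=
  (forall t : S, exists (s : seq J) (c : J -> A),
      t = \sum_(k <- s) i (c k) * e k) /\
  (forall (s : seq J) (c : J -> A), uniq s ->
      \sum_(k <- s) i (c k) * e k = 0 -> forall k, k \in s -> c k = 0).

Definition skew_derivation (B : pzRingType) (beta delta : B -> B) : Prop :=
  (forall a b, delta (a + b) = delta a + delta b) /\
  (forall a b, delta (a * b) = beta a * delta b + delta a * b).

(* S = B[x; sigma, delta], containing B through i: S is a free left B-module on
   the powers of x, and x b = sigma(b) x + delta(b).  This determines S up to a
   unique isomorphism over B preserving x. *)
Definition skew_polynomial_ring (B S : pzRingType) (sigma delta : B -> B)
    (i : {rmorphism B -> S}) (x : S) : Prop :=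
  left_basis i (fun n : nat => x ^+ n) /\
  (forall b, x * i b = i (sigma b) * x + i (delta b)).

(* y ^ n for an integer n, where yV is the inverse of y; exprz is not used
   because it would require a unitRingType, i.e. decidable units. *)
Definition int_power (S : pzRingType) (y yV : S) (n : int) : S :=
  match n with Posz k => y ^+ k | Negz k => yV ^+ k.+1 end.

(* S = A[y^{+1,-1}; alpha], containing A through i, with yV the inverse of y. *)
Definition skew_laurent_ring (A S : pzRingType) (alpha : A -> A)
    (i : {rmorphism A -> S}) (y yV : S) : Prop :=
  [/\ y * yV = 1, yV * y = 1,
      left_basis i (int_power y yV) &
      forall a, y * i a = i (alpha a) * y].

(* R = R(A, alpha, v, 1) = B[x; beta, delta] with B = A[y; alpha], where A sits
   in B through iA and B sits in R through iB; alphaV is the inverse of alpha. *)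
Record ambiskew_ring (K : comNzRingType) (A : algType K)
    (alpha alphaV : A -> A) (v : A)
    (B : algType K) (iA : {lrmorphism A -> B}) (y : B)
    (beta : {lrmorphism B -> B}) (delta : B -> B)
    (R : algType K) (iB : {lrmorphism B -> R}) (x : R) : Prop := {
  ambiskew_inner : skew_polynomial_ring alpha (fun=> 0) iA y;
  ambiskew_beta_base : forall a, beta (iA a) = iA (alphaV a);
  ambiskew_beta_y : beta y = y;
  ambiskew_derivation : skew_derivation beta delta;
  ambiskew_delta_base : forall a, delta (iA a) = 0;
  ambiskew_delta_y : delta y = iA v;
  ambiskew_outer : skew_polynomial_ring beta delta iB x
}.

(* The set K[c] \ {0} in a K-algebra. *)
Definition nonzero_polynomials_in (K : comNzRingType) (R : algType K) (c : R)
    (s : R) : Prop :=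
  (exists p : {poly K}, s = horner_alg c p) /\ s <> 0.

Definition invertible (R : pzRingType) (t : R) : Prop :=
  exists t' : R, t * t' = 1 /\ t' * t = 1.

(* Q is the localization of R at a multiplicatively closed set Z of central
   elements, with canonical map phi.  Since Z is central, left and right
   fractions coincide. *)
Definition central_localization (R Q : pzRingType) (Z : R -> Prop)
    (phi : {rmorphism R -> Q}) : Prop :=
  [/\ forall s, Z s -> invertible (phi s),
      forall q, exists r s, Z s /\ q * phi s = phi r &
      forall r, phi r = 0 <-> exists s, Z s /\ r * s = 0].

(* v^(m) = \sum_(l < m) alpha^l (v). *)
Definition orbit_sum (A : pzRingType) (alpha : A -> A) (v : A) (m : nat) : A :=
  \sum_(l < m) iter l alpha v.

(* Main.v *)
Require Import Defs.
From HB Require Import structures.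
From mathcomp Require Import all_boot all_algebra.
From Stdlib Require Import Classical.

Set Implicit Arguments.
Unset Strict Implicit.
Unset Printing Implicit Defensive.

Import GRing.Theory.
Local Open Scope ring_scope.

(* The Casimir element satisfies x y = z + u and y x = z + alpha(u), so after
   inverting y the ring R becomes S[z] with S = A[y, y^-1; alpha].

   If: let J be a nonzero ideal of R saturated with respect to K[z] \ {0}.
   Because S is simple with centre K, an element of J of least degree in z may
   be taken of the form g(z) y^k with g over K, so J contains y^k.  Then
   x y^m - y^m x = v^(m) y^(m-1) puts p_m(u) y^(m-1) in J, and u = x y - z gives
   p_m(u) y^(m-1) = p_m(-z) y^(m-1) modulo R y^m; hence J contains y^(m-1), and
   by descent 1.

   Only if: with alpha^(m-1)(c) = v^(m), the element y^m annihilates the left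
   module R / (R c + R y^m + R x), on whose generator z acts as -alpha(u).  If
   the localization is simple, this annihilator contains some q(z) with q
   nonzero, so q(-alpha(u)) lies in A c; applying alpha^(m-1) and using
   u = alpha^m(u) modulo v^(m) gives q(-u) in v^(m) A. *)

(** * Generators of free modules and iterated twists *)

Lemma left_basis_generated (A S : pzRingType) (i : A -> S) (J : eqType)
    (e : J -> S) (P : S -> Prop) :
    left_basis i e -> P 0 -> (forall s t, P s -> P t -> P (s + t)) ->
    (forall s t, P s -> P t -> P (s * t)) ->
    (forall a, P (i a)) -> (forall k, P (e k)) ->
  forall t, P t.
Proof.
move=> [gen _] P0 PD PM Pi Pe t; have [s [c ->]] := gen t.
by apply: (big_ind P) => // k _; apply: PM.
Qed.

Lemma mul_iter_skew (A S : pzRingType) (i : A -> S) (y : S) (s : A -> A) :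
    (forall a, y * i a = i (s a) * y) ->
  forall k a, y ^+ k * i a = i (iter k s a) * y ^+ k.
Proof.
move=> ys; elim=> [|k IH] a; first by rewrite mulr1 mul1r.
by rewrite exprS -mulrA IH mulrA ys -mulrA iterS.
Qed.

Lemma iter_cancel (T : Type) (f g : T -> T) k :
  cancel f g -> cancel (iter k f) (iter k g).
Proof. by move=> fK; elim: k => [|k IH] t //; rewrite iterSr iterS fK IH. Qed.

(** * Coefficient sequences evaluated at a skew variable *)

Section SkewEvaluation.

Variables (A S : nzRingType) (i : {rmorphism A -> S}) (y : S).

(** [{poly A}] serves here as a type of coefficient sequences, with coefficients written on the
    left. The map is additive, but since [y] need not commute with [A] it does not respect the
    product of [{poly A}]. *)
Definition skew_eval (f : {poly A}) : S := (map_poly i f).[y].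

Lemma skew_evalE f : skew_eval f = \sum_(k < size f) i f`_k * y ^+ k.
Proof.
rewrite /skew_eval (@horner_coef_wide _ (size f)) ?size_poly //.
by apply: eq_bigr => k _; rewrite coef_map.
Qed.

Lemma skew_eval0 : skew_eval 0 = 0.
Proof. by rewrite /skew_eval rmorph0 horner0. Qed.

Lemma skew_evalD f g : skew_eval (f + g) = skew_eval f + skew_eval g.
Proof. by rewrite /skew_eval rmorphD hornerD. Qed.

Lemma skew_evalN f : skew_eval (- f) = - skew_eval f.
Proof. by rewrite /skew_eval rmorphN hornerN. Qed.

Lemma skew_evalB f g : skew_eval (f - g) = skew_eval f - skew_eval g.
Proof. by rewrite skew_evalD skew_evalN. Qed.

Lemma skew_eval_sum (J : Type) (s : seq J) (F : J -> {poly A}) :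
  skew_eval (\sum_(k <- s) F k) = \sum_(k <- s) skew_eval (F k).
Proof. exact: (big_morph _ skew_evalD skew_eval0). Qed.

Lemma skew_evalC a : skew_eval a%:P = i a.
Proof. by rewrite /skew_eval map_polyC hornerC. Qed.

Lemma skew_evalCM a f : skew_eval (a%:P * f) = i a * skew_eval f.
Proof. by rewrite /skew_eval rmorphM /= map_polyC hornerCM. Qed.

Lemma skew_evalMX f : skew_eval (f * 'X) = skew_eval f * y.
Proof. by rewrite /skew_eval rmorphM /= map_polyX hornerMX. Qed.

Lemma skew_evalMXn f n : skew_eval (f * 'X^n) = skew_eval f * y ^+ n.
Proof.
elim: n => [|n IH]; first by rewrite !expr0 !mulr1.
by rewrite !exprSr !mulrA skew_evalMX IH.
Qed.

Lemma skew_evalXn n : skew_eval 'X^n = y ^+ n.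
Proof. by rewrite -['X^n]mul1r skew_evalMXn skew_evalC rmorph1 mul1r. Qed.

Lemma skew_evalX : skew_eval 'X = y.
Proof. by rewrite /skew_eval map_polyX hornerX. Qed.

Lemma skew_eval_surj (B : left_basis i (fun n : nat => y ^+ n)) t :
  exists f, t = skew_eval f.
Proof.
have [s [c ->]] := B.1 t.
exists (\sum_(k <- s) (c k)%:P * 'X^k).
by rewrite skew_eval_sum; apply: eq_bigr => k _; rewrite skew_evalMXn skew_evalC.
Qed.

Lemma left_basis_decomp (B : left_basis i (fun n : nat => y ^+ n)) t :
  exists a t', t = i a + t' * y.
Proof.
have [f ->] := skew_eval_surj B t; elim/poly_ind: f => [|f a _].
  by exists 0, 0; rewrite skew_eval0 rmorph0 mul0r addr0.
by exists a, (skew_eval f); rewrite skew_evalD skew_evalMX skew_evalC addrC.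
Qed.

(** The map [h] places the exponents inside the index set of the basis, so that one argument serves
    both skew polynomials (indices in [nat]) and Laurent polynomials (indices in [int]). *)
Lemma skew_eval_basis_eq0 (J : eqType) (e : J -> S) (h : nat -> J)
    (h' : J -> nat) :
    left_basis i e -> cancel h h' -> (forall n, e (h n) = y ^+ n) ->
  forall f, skew_eval f = 0 -> f = 0.
Proof.
move=> [_ ind] hK eh f f0; apply/polyP => n; rewrite coef0.
have [le|lt] := leqP (size f) n; first by rewrite nth_default.
have hI := can_inj hK.
have hu : uniq (map h (iota 0 (size f))) by rewrite map_inj_uniq ?iota_uniq.
rewrite -(hK n); apply: (ind _ (fun j => f`_(h' j)) hu).
  rewrite big_map -[RHS]f0 skew_evalE.
  rewrite -(big_mkord xpredT (fun k => i f`_k * y ^+ k)) /index_iota subn0.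
  by apply: eq_bigr => k _; rewrite hK eh.
by rewrite mem_map // mem_iota.
Qed.

(** Writing [t] as a skew polynomial, freeness forces the constant coefficient of [f * 'X - a%:P] to
    vanish. *)
Lemma left_basis_decomp_eq0 (B : left_basis i (fun n : nat => y ^+ n)) a t :
  i a = t * y -> a = 0.
Proof.
have [f ->] := skew_eval_surj B t; rewrite -skew_evalMX -skew_evalC => fE.
have : f * 'X - a%:P = 0.
  apply: (skew_eval_basis_eq0 (h := id) (h' := id) B) => //.
  by rewrite skew_evalB fE subrr.
move/(congr1 (fun g : {poly A} => g`_0)); rewrite coefB coefMX coefC coef0 sub0r.
by move/eqP; rewrite oppr_eq0 => /eqP.
Qed.

Variable alpha : {rmorphism A -> A}.
Hypothesis y_comm : forall a, y * i a = i (alpha a) * y.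

Lemma mul_skew_eval f : y * skew_eval f = skew_eval (map_poly alpha f) * y.
Proof.
elim/poly_ind: f => [|f c IH]; first by rewrite rmorph0 skew_eval0 mulr0 mul0r.
rewrite rmorphD rmorphM /= map_polyX map_polyC !skew_evalD !skew_evalMX !skew_evalC.
by rewrite mulrDr mulrDl mulrA IH y_comm.
Qed.

End SkewEvaluation.

(* The product of A[y; alpha], as an operation on coefficient sequences. *)
Definition skew_mul (A : nzRingType) (alpha : {rmorphism A -> A})
    (f g : {poly A}) : {poly A} :=
  \sum_(k < size f) (f`_k)%:P * iter k (map_poly alpha) g * 'X^k.

(** [skew_mul] depends on [A] and [alpha] alone, so every ring in which [y] twists [A] by [alpha]
    multiplies by the same formula. This is what carries products from [A[y; alpha]] to the Laurent
    ring. *)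
Lemma skew_evalM (A S : nzRingType) (i : {rmorphism A -> S}) (y : S)
    (alpha : {rmorphism A -> A}) (y_comm : forall a, y * i a = i (alpha a) * y)
    (f g : {poly A}) :
  skew_eval i y (skew_mul alpha f g) = skew_eval i y f * skew_eval i y g.
Proof.
rewrite skew_eval_sum [skew_eval i y f]skew_evalE mulr_suml.
apply: eq_bigr => k _; rewrite skew_evalMXn skew_evalCM -!mulrA; congr (_ * _).
elim: (nat_of_ord k) g => [|n IH] g; first by rewrite mulr1 mul1r.
by rewrite iterSr exprSr mulrA IH -!mulrA (mul_skew_eval y_comm).
Qed.

(** * Evaluation of scalar polynomials in algebras *)

Section HornerAlg.

Variables (K : comNzRingType).

Lemma rmorph_horner_alg (A S : algType K) (i : {lrmorphism A -> S}) c p :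
  i (horner_alg c p) = horner_alg (i c) p.
Proof.
elim/poly_ind: p => [|p k IH]; first by rewrite !rmorph0.
by rewrite !rmorphD !rmorphM /= IH !horner_algX !horner_algC linearZ /= rmorph1.
Qed.

(** The factor theorem for two commuting points of a noncommutative algebra. *)
Lemma horner_alg_sub (S : algType K) (c d : S) p :
    c * d = d * c ->
  exists h, horner_alg c p - horner_alg d p = h * (c - d).
Proof.
move=> cd; elim/poly_ind: p => [|p k [h IH]]; first by exists 0; rewrite !rmorph0 subrr mul0r.
exists (h * c + horner_alg d p).
rewrite !rmorphD !rmorphM /= !horner_algX !horner_algC opprD addrACA subrr addr0.
have cE : c * (c - d) = (c - d) * c by rewrite mulrBr mulrBl cd.
by rewrite mulrDl -mulrA cE mulrA -IH mulrBl mulrBr addrA subrK.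
Qed.



Lemma horner_algN (S : algType K) (c : S) p :
  horner_alg (- c) p = horner_alg c (p \Po - 'X).
Proof.
elim/poly_ind: p => [|p k IH]; first by rewrite comp_poly0 !rmorph0.
rewrite comp_polyD comp_polyM comp_polyX comp_polyC !rmorphD !rmorphM /= IH.
by rewrite rmorphN /= !horner_algX !horner_algC.
Qed.

Lemma comp_polyN_neq0 (p : {poly K}) : p <> 0 -> p \Po - 'X <> 0.
Proof.
move=> p0 pN; case: p0; rewrite -(comp_polyXr p) -(opprK 'X).
have -> : - - 'X = - 'X \Po - 'X :> {poly K} by rewrite rmorphN /= comp_polyX.
by rewrite comp_polyA pN comp_poly0.
Qed.

End HornerAlg.

(** * Comparison of [A[y; alpha]] with its Laurent ring *)

Section Laurent.

Variables (K : fieldType) (A B L : algType K).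
Variables (alpha : {lrmorphism A -> A}) (alphaV : A -> A).
Hypothesis alphaVK : cancel alphaV alpha.
Variables (iA : {lrmorphism A -> B}) (y : B).
Hypothesis B_skew : skew_polynomial_ring alpha (fun=> 0) iA y.
Variables (iL : {lrmorphism A -> L}) (yL yLV : L).
Hypothesis L_laurent : skew_laurent_ring alpha iL yL yLV.

Local Notation evB := (skew_eval iA y).
Local Notation evL := (skew_eval iL yL).

Lemma skew_poly_comm a : y * iA a = iA (alpha a) * y.
Proof. by rewrite B_skew.2 rmorph0 addr0. Qed.

Lemma skew_poly_surj b : exists f, b = evB f.
Proof. exact: (skew_eval_surj B_skew.1). Qed.

Lemma skew_poly_eval_eq0 f : evB f = 0 -> f = 0.
Proof. exact: (skew_eval_basis_eq0 (h := id) (h' := id) B_skew.1). Qed.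

Lemma laurent_comm a : yL * iL a = iL (alpha a) * yL.
Proof. by have [_ _ _ ->] := L_laurent. Qed.

Lemma laurent_mulyV : yL * yLV = 1. Proof. by case: (L_laurent). Qed.

Lemma laurent_mulVy : yLV * yL = 1. Proof. by case: (L_laurent). Qed.

Lemma laurent_commV a : yLV * iL a = iL (alphaV a) * yLV.
Proof.
rewrite -[LHS]mulr1 -laurent_mulyV -{1}(alphaVK a) !mulrA -[yLV * _ * yL]mulrA.
by rewrite -laurent_comm mulrA laurent_mulVy mul1r.
Qed.

Lemma laurent_comm_right k a : iL a * yL ^+ k = yL ^+ k * iL (iter k alphaV a).
Proof.
by rewrite (mul_iter_skew laurent_comm) (iter_cancel k alphaVK).
Qed.

Lemma laurent_eval_eq0 f : evL f = 0 -> f = 0.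
Proof.
have [_ _ basis _] := L_laurent.
exact: (skew_eval_basis_eq0 (h := Posz) (h' := absz) basis).
Qed.

Lemma laurent_eval_inj : injective evL.
Proof.
move=> f g fg; apply/eqP; rewrite -subr_eq0; apply/eqP/laurent_eval_eq0.
by rewrite skew_evalB fg subrr.
Qed.

Lemma skew_poly_eval_inj : injective evB.
Proof.
move=> f g fg; apply/eqP; rewrite -subr_eq0; apply/eqP/skew_poly_eval_eq0.
by rewrite skew_evalB fg subrr.
Qed.

Lemma laurent_generated (P : L -> Prop) :
    P 0 -> (forall s t, P s -> P t -> P (s + t)) ->
    (forall s t, P s -> P t -> P (s * t)) ->
    (forall a, P (iL a)) -> P yL -> P yLV ->
  forall t, P t.
Proof.
move=> P0 PD PM Pi Py PV; have [_ _ basis _] := L_laurent.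
have PX t n : P t -> P (t ^+ n).
  move=> Pt; elim: n => [|n IH]; first by rewrite expr0 -(rmorph1 iL); apply: Pi.
  by rewrite exprS; apply: PM.
by apply: (left_basis_generated basis) => // -[n|n] /=; apply: PX.
Qed.

Lemma laurent_transfer f g f' g' :
  evB f * evB g = evB f' * evB g' -> evL f * evL g = evL f' * evL g'.
Proof.
rewrite -!(skew_evalM skew_poly_comm) -!(skew_evalM laurent_comm).
by move/skew_poly_eval_inj->.
Qed.

Hypothesis L_simple : simple_ring L.

(* [{l | y^j l y^k in I for some j, k}] is an ideal of the Laurent ring
   because [y] normalises the coefficients; two exponents are needed since
   [I] need not be stable under conjugation by the inverse of [y]. *)
Lemma skew_poly_ideal_power (I : B -> Prop) b :
  two_sided_ideal I -> I b -> b <> 0 -> exists k, I (y ^+ k).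
Proof.
move=> [I0 ID IMl IMr] Ib b0.
(* [F] is the copy of [I] in the Laurent ring. It is stable under multiplication by polynomials in
   [yL] on both sides; [G] below adds the negative powers. *)
pose F l := exists2 f, I (evB f) & l = evL f.
have FD l1 l2 : F l1 -> F l2 -> F (l1 + l2).
  move=> [f If ->] [g Ig ->]; exists (f + g); last by rewrite skew_evalD.
  by rewrite skew_evalD; apply: ID.
have FMl g l : F l -> F (evL g * l).
  move=> [f If ->]; exists (skew_mul alpha g f); last by rewrite (skew_evalM laurent_comm).
  by rewrite (skew_evalM skew_poly_comm); apply: IMl.
have FMr g l : F l -> F (l * evL g).
  move=> [f If ->]; exists (skew_mul alpha f g); last by rewrite (skew_evalM laurent_comm).
  by rewrite (skew_evalM skew_poly_comm); apply: IMr.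
have FXl n l : F l -> F (yL ^+ n * l) by rewrite -(skew_evalXn iL); apply: FMl.
have FXr n l : F l -> F (l * yL ^+ n) by rewrite -(skew_evalXn iL); apply: FMr.
pose G l := exists j k, F (yL ^+ j * l * yL ^+ k).
have G0 : G 0.
  by exists 0%N, 0%N; exists 0; rewrite skew_eval0 // mulr0 mul0r.
have GD l1 l2 : G l1 -> G l2 -> G (l1 + l2).
  move=> [j1 [k1 F1]] [j2 [k2 F2]]; exists (j1 + j2)%N, (k1 + k2)%N.
  rewrite mulrDr mulrDl; apply: FD.
    by rewrite addnC !exprD -!mulrA; apply: FXl; rewrite !mulrA; apply: FXr; rewrite -?mulrA // mulrA.
  by rewrite [(k1 + k2)%N]addnC !exprD -!mulrA; apply: FXl; rewrite !mulrA; apply: FXr.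
have GMl t : forall l, G l -> G (t * l).
  elim/laurent_generated: t => [l|s t Gs Gt l Gl|s t Gs Gt l Gl|a l|l|l].
  - by rewrite mul0r.
  - by rewrite mulrDl; apply: GD; [apply: Gs | apply: Gt].
  - by rewrite -mulrA; apply/Gs/Gt.
  - case=> j [k Fl]; exists j, k.
    rewrite mulrA (mul_iter_skew laurent_comm) -!mulrA -(skew_evalC iL yL).
    by apply: FMl; rewrite mulrA.
  - case=> j [k Fl]; exists j, k.
    by rewrite mulrA -exprSr exprS -!mulrA; apply: (FXl 1%N); rewrite mulrA.
  (* The extra factor [yL] on the left cancels [yLV]. *)
  - case=> j [k Fl]; exists j.+1, k.
    by rewrite exprSr mulrA -[_ * yL * yLV]mulrA laurent_mulyV mulr1.
have GMr t : forall l, G l -> G (l * t).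
  elim/laurent_generated: t => [l|s t Gs Gt l Gl|s t Gs Gt l Gl|a l|l|l].
  - by rewrite mulr0.
  - by rewrite mulrDr; apply: GD; [apply: Gs | apply: Gt].
  - by rewrite mulrA; apply/Gt/Gs.
  - case=> j [k Fl]; exists j, k.
    by rewrite -!mulrA laurent_comm_right -(skew_evalC iL yL) !mulrA; apply: FMr.
  - case=> j [k Fl]; exists j, k.
    by rewrite -!mulrA -exprS exprSr !mulrA; apply: (FXr 1%N).
  - case=> j [k Fl]; exists j, k.+1.
    by rewrite exprS !mulrA -[_ * yLV * yL]mulrA laurent_mulVy mulr1.
have [f bE] := skew_poly_surj b.
have Gf : G (evL f) by exists 0%N, 0%N; exists f; rewrite ?mul1r ?mulr1 -?bE.
have [Gz|G1] := L_simple.2 G (And4 G0 GD (fun t l => @GMl t l) (fun l t => @GMr t l)).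
  by case: b0; rewrite bE (laurent_eval_eq0 (Gz _ Gf)) skew_eval0.
(* That [1] lies in [G] says that some power of [yL] lies in [F]; injectivity of the evaluation
   brings it back to [I]. *)
have [j [k [g Ig]]] := G1 1; rewrite mulr1 -exprD -(skew_evalXn iL).
by move/laurent_eval_inj => gE; exists (j + k)%N; rewrite -(skew_evalXn iA) gE.
Qed.

Hypothesis L_center : forall c : L, central c <-> exists k : K, c = k%:A.

(** In the Laurent ring, [b] times the inverse of [y^k] commutes with [A] and with [y]. It is
    therefore central, hence a scalar, and multiplying back by [y^k] recovers [b]. *)
Lemma skew_poly_twisted_center b k :
    y * b = b * y -> (forall a, iA (iter k alpha a) * b = b * iA a) ->
  exists c : K, b = c *: y ^+ k.
Proof.
have [f ->] := skew_poly_surj b; move=> yb ab.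
have yf : yL * evL f = evL f * yL.
  by have:= @laurent_transfer 'X f f 'X; rewrite !skew_evalX; apply.
have af a : iL (iter k alpha a) * evL f = evL f * iL a.
  have:= @laurent_transfer (iter k alpha a)%:P f f a%:P.
  by rewrite !skew_evalC; apply; apply: ab.
have VX : yLV ^+ k * yL ^+ k = 1.
  elim: (k) => [|n IH]; first by rewrite mulr1.
  by rewrite exprSr exprS mulrA -[_ * yLV * yL]mulrA laurent_mulVy mulr1.
pose c := evL f * yLV ^+ k.
have cy : c * yL = yL * c.
  rewrite /c mulrA yf -!mulrA; congr (_ * _).
  by apply/commr_sym/commrX; rewrite /GRing.comm laurent_mulyV laurent_mulVy.
have c_central : central c.
  elim/laurent_generated => [|s t cs ct|s t cs ct|a||].
  - by rewrite mulr0 mul0r.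
  - by rewrite mulrDr mulrDl cs ct.
  - by rewrite mulrA cs -mulrA ct mulrA.
  - by rewrite /c -mulrA (mul_iter_skew laurent_commV) mulrA -af mulrA
               (iter_cancel k alphaVK).
  - exact: cy.
  - by rewrite -[c * yLV]mul1r -laurent_mulVy -mulrA [yL * _]mulrA -cy -mulrA laurent_mulyV mulr1.
have [d cE] := (L_center c).1 c_central.
exists d; have -> : f = (d%:A)%:P * 'X^k.
  apply: laurent_eval_inj; rewrite skew_evalCM skew_evalXn /= rmorph_alg -cE.
  by rewrite /c -mulrA VX mulr1.
by rewrite skew_evalCM skew_evalXn /= rmorph_alg -scalerAl mul1r.
Qed.

End Laurent.

(** * The ambiskew ring and its Casimir element *)

Section Ambiskew.

Variables (K : fieldType) (A : algType K).
Variables (alpha : {lrmorphism A -> A}) (alphaV : A -> A).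
Hypotheses (alphaK : cancel alpha alphaV) (alphaVK : cancel alphaV alpha).
Variables (v : A) (B : algType K) (iA : {lrmorphism A -> B}) (y : B).
Variables (beta : {lrmorphism B -> B}) (delta : B -> B).
Variables (R : algType K) (iB : {lrmorphism B -> R}) (x : R).
Hypothesis R_ambiskew : ambiskew_ring alpha alphaV v iA y beta delta iB x.
Variable u : A.
Hypotheses (u_central : central u) (u_splits : v = u - alpha u).
Variable z : R.
Hypothesis z_def : z = x * iB y - iB (iA u).

Local Notation aR a := (iB (iA a)).
Local Notation Y := (iB y).
Local Notation evR := (skew_eval iB x).
Local Notation evZ := (skew_eval iB z).

Lemma iter_alpha_central k : central (iter k alpha u).
Proof.
elim: k => [|k IH] // a; rewrite iterS -(alphaVK a) -!rmorphM.
by rewrite IH.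
Qed.

Lemma orbit_sum_split m : orbit_sum alpha v m = u - iter m alpha u.
Proof.
rewrite /orbit_sum; elim: m => [|m IH]; first by rewrite big_ord0 subrr.
rewrite big_ord_recr /= IH; suff -> : iter m alpha v = iter m alpha u - iter m.+1 alpha u.
  by rewrite addrA subrK.
rewrite u_splits iterSr; elim: {IH}m => [|m IH] //.
by rewrite !iterS IH rmorphB.
Qed.

Lemma orbit_sum_central m : central (orbit_sum alpha v m).
Proof.
move=> a; rewrite orbit_sum_split mulrBl mulrBr u_central.
by rewrite iter_alpha_central.
Qed.

Let inner := ambiskew_inner R_ambiskew.
Let outer := ambiskew_outer R_ambiskew.

Lemma ambiskew_y_comm a : Y * aR a = aR (alpha a) * Y.
Proof. by rewrite -!rmorphM (skew_poly_comm inner). Qed.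

Lemma ambiskew_x_comm a : x * aR a = aR (alphaV a) * x.
Proof.
rewrite outer.2 (ambiskew_beta_base R_ambiskew).
by rewrite (ambiskew_delta_base R_ambiskew) rmorph0 addr0.
Qed.

Lemma ambiskew_xy : x * Y = Y * x + aR v.
Proof.
by rewrite outer.2 (ambiskew_beta_y R_ambiskew) (ambiskew_delta_y R_ambiskew).
Qed.

Lemma casimir_xy : x * Y = z + aR u.
Proof. by rewrite z_def subrK. Qed.

Lemma casimir_yx : Y * x = z + aR (alpha u).
Proof.
have /eqP := ambiskew_xy; rewrite casimir_xy -subr_eq => /eqP <-.
by rewrite u_splits !rmorphB opprB addrA -[_ + _ - _]addrA [aR _ + _]addrC addrA addrK.
Qed.

Lemma ambiskew_generated (P : R -> Prop) :
    P 0 -> (forall s t, P s -> P t -> P (s + t)) ->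
    (forall s t, P s -> P t -> P (s * t)) ->
    (forall a, P (aR a)) -> P Y -> P x ->
  forall t, P t.
Proof.
move=> P0 PD PM Pa Py Px.
have PX t n : P t -> P (t ^+ n).
  move=> Pt; elim: n => [|n IH]; last by rewrite exprS; apply: PM.
  by rewrite expr0 -(rmorph1 iB) -(rmorph1 iA); apply: Pa.
apply: (left_basis_generated outer.1) => // [|n]; last exact: PX.
apply: (left_basis_generated inner.1) => // [|s t Ps Pt|s t Ps Pt|n].
- by rewrite rmorph0.
- by rewrite rmorphD; apply: PD.
- by rewrite rmorphM; apply: PM.
- by rewrite rmorphXn; apply: PX.
Qed.

(** Past [x] or [y], the form [x y - u] turns into the form [y x - alpha u], and both equal [z].
    Past [A], the twists by [alpha] and [alphaV] cancel. *)
Lemma casimir_central t : z * t = t * z.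
Proof.
have zE : z = x * Y - aR u by rewrite casimir_xy addrK.
have zE' : z = Y * x - aR (alpha u) by rewrite casimir_yx addrK.
elim/ambiskew_generated: t => [|s t zs zt|s t zs zt|a||].
- by rewrite mulr0 mul0r.
- by rewrite mulrDr mulrDl zs zt.
- by rewrite mulrA zs -mulrA zt mulrA.
- rewrite zE mulrBl mulrBr -mulrA ambiskew_y_comm mulrA ambiskew_x_comm alphaK mulrA.
  by rewrite -!rmorphM u_central.
- by rewrite {1}zE' zE mulrBl mulrBr ambiskew_y_comm mulrA.
- by rewrite {1}zE zE' mulrBl mulrBr ambiskew_x_comm alphaK mulrA.
Qed.

Lemma ambiskew_surj r : exists f, r = evR f.
Proof. exact: (skew_eval_surj outer.1). Qed.

Lemma ambiskew_eval_eq0 f : evR f = 0 -> f = 0.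
Proof. exact: (skew_eval_basis_eq0 (h := id) (h' := id) outer.1). Qed.

Lemma skew_poly_y_neq0 k : y ^+ k <> 0.
Proof.
rewrite -(skew_evalXn iA) => /(skew_poly_eval_eq0 inner)/eqP.
by rewrite -size_poly_eq0 size_polyXn.
Qed.

Lemma skew_poly_y_reg b : y * b = 0 -> b = 0.
Proof.
have [f ->] := skew_poly_surj inner b.
rewrite (mul_skew_eval (skew_poly_comm inner)) -skew_evalMX.
move/(skew_poly_eval_eq0 inner)/polyP => f0.
suff -> : f = 0 by rewrite skew_eval0.
apply/polyP => n; have := f0 n.+1; rewrite coefMX coef_map !coef0 /= => fn.
by apply: (can_inj alphaK); rewrite rmorph0.
Qed.

(** Left multiplication by [y] acts on the coefficients of an expansion in [x]; on these it is
    injective because [alpha] is. *)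
Lemma ambiskew_y_reg k r : Y ^+ k * r = 0 -> r = 0.
Proof.
elim: k r => [|k IH] r; first by rewrite mul1r.
rewrite exprSr -mulrA => /IH.
have [g ->] := ambiskew_surj r; rewrite -skew_evalCM => /ambiskew_eval_eq0/polyP g0.
suff -> : g = 0 by rewrite skew_eval0.
by apply/polyP => n; have := g0 n; rewrite coefCM coef0 => /skew_poly_y_reg.
Qed.

(** Being central, [z] can be moved between each coefficient and the power of [x], where it is
    replaced by [y x - alpha u]. *)
Lemma casimir_mul_eval f :
  z * evR f = evR (f * (y%:P * 'X - (iA (alpha u))%:P)).
Proof.
elim/poly_ind: f => [|f c IH]; first by rewrite mul0r skew_eval0 mulr0.
rewrite mulrDl -mulrA -commr_polyX mulrA !skew_evalD !skew_evalMX -IH.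
rewrite mulrDr mulrA; congr (_ + _).
rewrite skew_evalCM skew_evalB skew_evalMX !skew_evalC casimir_central.
by rewrite casimir_yx addrK.
Qed.

Lemma horner_casimir (g : {poly K}) n : (size g <= n.+1)%N ->
  exists f, [/\ horner_alg z g = evR f, (size f <= n.+1)%N & f`_n = g`_n *: y ^+ n].
Proof.
elim/poly_ind: g n => [|g c IH] n.
  by exists 0; rewrite rmorph0 skew_eval0 !coef0 scale0r size_poly0.
rewrite size_MXaddC => sz.
have {sz} : (size g <= n)%N.
  by case: ifP sz => [/andP[/eqP-> _]|_]; rewrite ?size_poly0.
case: n => [|n]; first rewrite leqn0 size_poly_eq0 => /eqP->.
  exists (c%:A)%:P; split.
  - by rewrite mul0r add0r horner_algC skew_evalC /= rmorph_alg.
  - exact: size_polyC_leq1.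
  - by rewrite mul0r add0r !coefC.
case/IH=> f [gE sf fn].
exists (f * (y%:P * 'X - (iA (alpha u))%:P) + (c%:A)%:P); split.
- rewrite skew_evalD -casimir_mul_eval skew_evalC /= rmorph_alg -gE.
  by rewrite rmorphD rmorphM /= horner_algX horner_algC casimir_central.
- rewrite mulrBr mulrA; apply/leq_sizeP => -[|j] // ltj.
  rewrite !coefD coefN coefMX !coefMC coefC /= addr0.
  by rewrite !nth_default ?mul0r ?subrr // (leq_trans sf) // ltnW.
- rewrite mulrBr mulrA !coefD coefN !coefMX !coefMC !coefC /= !addr0.
  by rewrite (nth_default _ sf) mul0r subr0 fn -scalerAl -exprSr.
Qed.

(** As a polynomial in [x], [z] has leading coefficient [y]. So [g(z)] of degree [n] has top
    coefficient a nonzero scalar times [y^n]. *)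
Lemma casimir_transcendental (g : {poly K}) : horner_alg z g = 0 -> g = 0.
Proof.
move=> gz; apply/eqP; apply/negPn/negP => g0.
have [|f [fE _]] := @horner_casimir g (size g).-1.
  by rewrite prednK // size_poly_gt0.
rewrite gz in fE; rewrite (ambiskew_eval_eq0 (esym fE)) coef0 => /esym/eqP.
rewrite scaler_eq0 => /orP[|/eqP/skew_poly_y_neq0 //].
by rewrite -/(lead_coef g) lead_coef_eq0 (negPf g0).
Qed.

Lemma nonzero_polynomials_casimir s :
  nonzero_polynomials_in z s <-> exists2 p, p <> 0 & s = horner_alg z p.
Proof.
split=> [[[p ->] p0]|[p p0 ->]].
  by exists p => // pE; apply: p0; rewrite pE rmorph0.
by split; [exists p | move/casimir_transcendental].
Qed.

Lemma casimir_evalMC f b : evZ (f * b%:P) = evZ f * iB b.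
Proof.
elim/poly_ind: f => [|f c IH]; first by rewrite mul0r skew_eval0 mul0r.
rewrite mulrDl -mulrA -commr_polyX mulrA !skew_evalD !skew_evalMX IH.
by rewrite -polyCM !skew_evalC rmorphM mulrDl -!mulrA casimir_central.
Qed.

Lemma y_normal b : exists b', y * b = b' * y.
Proof.
have [f ->] := skew_poly_surj inner b.
by rewrite (mul_skew_eval (skew_poly_comm inner)); eexists.
Qed.

Lemma y_casimir_eval f : exists f', Y * evZ f = evZ f' * Y.
Proof.
elim/poly_ind: f => [|f b [f' IH]]; first by exists 0; rewrite skew_eval0 mul0r mulr0.
have [b' bE] := y_normal b; exists (f' * 'X + b'%:P).
rewrite !skew_evalD !skew_evalMX !skew_evalC mulrDr mulrDl -[in RHS]rmorphM -bE.
by rewrite rmorphM mulrA IH -!mulrA casimir_central.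
Qed.

(* Since [y x = z + alpha u], multiplying by a power of [y] turns powers of
   [x] into powers of [z]. *)
Lemma ambiskew_casimir_denominator r : exists k f, Y ^+ k * r = evZ f.
Proof.
have [g ->] := ambiskew_surj r.
elim/poly_ind: g => [|g b [k [f IH]]]; first by exists 0%N, 0; rewrite !skew_eval0 mulr0.
have [f' fE] := y_casimir_eval f.
exists k.+1, (f' * 'X + f' * (iA (alpha u))%:P + (y ^+ k.+1 * b)%:P).
rewrite !skew_evalD !skew_evalMX casimir_evalMC !skew_evalC -mulrDr -casimir_yx.
by rewrite mulrA -fE -IH mulrDr rmorphM rmorphXn exprS !mulrA.
Qed.

Lemma horner_alg_casimir_eval (g : {poly K}) b :
  evZ (map_poly (GRing.in_alg B) g * b%:P) = horner_alg z g * iB b.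
Proof.
rewrite casimir_evalMC; congr (_ * _).
elim/poly_ind: g => [|g c IH]; first by rewrite !rmorph0 skew_eval0.
rewrite !rmorphD !rmorphM /= map_polyX map_polyC skew_evalD skew_evalMX skew_evalC IH.
by rewrite horner_algX horner_algC /= rmorph_alg.
Qed.

Lemma poly_in_line (b : B) (f : {poly B}) :
    (forall n, exists c : K, f`_n = c *: b) ->
  exists g, f = map_poly (GRing.in_alg B) g * b%:P.
Proof.
elim/poly_ind: f => [|f d IH] fb; first by exists 0; rewrite rmorph0 mul0r.
have [|g ->] := IH.
  move=> n; have [c] := fb n.+1.
  by rewrite coefD coefMX coefC /= addr0 => ->; exists c.
have [c] := fb 0%N; rewrite coefD coefMX coefC /= add0r => ->.
exists (g * 'X + c%:P); rewrite !rmorphD !rmorphM /= map_polyX map_polyC /=.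
by rewrite mulrDl -polyCM -scalerAl mul1r -!mulrA commr_polyX.
Qed.

(** With [x y = z + u] and [y x = z + alpha u], both products reduce to multiples of [y^m]; the
    terms in [z] cancel and leave [u - alpha^(m+1)(u)]. *)
Lemma x_y_power m :
  x * Y ^+ m.+1 = Y ^+ m.+1 * x + aR (orbit_sum alpha v m.+1) * Y ^+ m.
Proof.
rewrite exprS mulrA casimir_xy -exprS exprSr -[_ * Y * x]mulrA casimir_yx.
rewrite mulrDl mulrDr casimir_central -addrA; congr (_ + _).
rewrite (mul_iter_skew ambiskew_y_comm) -mulrDl -!rmorphD orbit_sum_split iterSr.
by rewrite addrC subrK.
Qed.

(** * Powers of [y] in saturated ideals *)

Section PowersInIdeals.

Variables (L : algType K) (iL : {lrmorphism A -> L}) (yL yLV : L).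
Hypothesis L_laurent : skew_laurent_ring alpha iL yL yLV.
Hypothesis L_simple : simple_ring L.
Hypothesis L_center : forall c : L, central c <-> exists k : K, c = k%:A.

Variable J : R -> Prop.
Hypothesis J_ideal : two_sided_ideal J.
Hypothesis J_saturated :
  forall (g : {poly K}) r, g <> 0 -> J (horner_alg z g * r) -> J r.

(* A nonzero element of [J] of least degree in [z] can be chosen with leading
   coefficient [y^k]; its twisted commutators with [A] and [y] have smaller
   degree, so they vanish and the element is [g(z) y^k] with [g] over [K]. *)
Lemma casimir_eval_power f : f <> 0 -> J (evZ f) -> exists k, J (Y ^+ k).
Proof.
have [J0 JD JMl JMr] := J_ideal.
have JB a b : J a -> J b -> J (a - b).
  by move=> Ja Jb; apply: JD => //; rewrite -mulN1r; apply: JMl.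
have [n] := ubnP (size f); elim: n f => // n IH f sf f0 Jf.
(* Either a shorter nonzero element exists and induction applies, or [n] is the least size and [f]
   attains it. *)
have [[f' [f'0 Jf' sf']]|min] :=
    classic (exists f', [/\ f' <> 0, J (evZ f') & (size f' < n)%N]).
  exact: (IH f').
have {IH}minimal d : J (evZ d) -> (size d <= n)%N -> d`_n.-1 = 0 -> d = 0.
  move=> Jd sd dn; apply: NNPP => d0; apply: min; exists d; split=> //.
  case: n sd dn {sf IH} => [|n] sd dn.
    by case: d0; apply/eqP; rewrite -size_poly_eq0 -leqn0.
  rewrite ltnS; apply/leq_sizeP => j; rewrite leq_eqVlt => /orP[/eqP<- //|ltj].
  by rewrite nth_default // (leq_trans sd).
(* The coefficients in degree [n.-1], the top one by minimality, form an ideal of [B]; by simplicity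
   of the Laurent ring it contains a power of [y]. *)
pose I b := exists f', [/\ J (evZ f'), (size f' <= n)%N & f'`_n.-1 = b].
have I_ideal : two_sided_ideal I.
  split.
  - by exists 0; rewrite skew_eval0 size_poly0 coef0.
  - move=> b c [f1 [J1 s1 <-]] [f2 [J2 s2 <-]]; exists (f1 + f2); split.
    + by rewrite skew_evalD; apply: JD.
    + by rewrite (leq_trans (size_polyD _ _)) // geq_max s1.
    + by rewrite coefD.
  - move=> c b [f1 [J1 s1 <-]]; exists (c%:P * f1); split.
    + by rewrite skew_evalCM; apply: JMl.
    + by apply/leq_sizeP => j sj; rewrite coefCM nth_default ?mulr0 ?(leq_trans s1).
    + by rewrite coefCM.
  - move=> b c [f1 [J1 s1 <-]]; exists (f1 * c%:P); split.
    + by rewrite casimir_evalMC; apply: JMr.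
    + by apply/leq_sizeP => j sj; rewrite coefMC nth_default ?mul0r ?(leq_trans s1).
    + by rewrite coefMC.
have If : I f`_n.-1 by exists f.
have fn0 : f`_n.-1 <> 0 by move=> fn; apply: f0; apply: minimal.
have [k [h [Jh sh hn]]] :=
  skew_poly_ideal_power alphaVK inner L_laurent L_simple I_ideal If fn0.
have twisted b c : b * y ^+ k = y ^+ k * c -> b%:P * h = h * c%:P.
  move=> bc; apply/eqP; rewrite -subr_eq0; apply/eqP/minimal.
  - by rewrite skew_evalB skew_evalCM casimir_evalMC; apply: JB; [apply: JMl|apply: JMr].
  - apply/leq_sizeP => j sj; rewrite coefB coefCM coefMC.
    by rewrite nth_default ?(leq_trans sh) // mulr0 mul0r subrr.
  - by rewrite coefB coefCM coefMC hn bc subrr.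
(* The relations [twisted] hold coefficient by coefficient, so each coefficient of [h] is a scalar
   multiple of [y^k]. *)
have [j|g hE] := @poly_in_line (y ^+ k) h.
  apply: (skew_poly_twisted_center alphaVK inner L_laurent L_center).
    by rewrite -coefCM -coefMC (twisted y y) -?exprS -?exprSr.
  move=> a; rewrite -coefCM -coefMC (twisted _ (iA a)) //.
  by rewrite (mul_iter_skew (skew_poly_comm inner)).
exists k; rewrite -rmorphXn; apply: (J_saturated (g := g)).
  by move=> g0; apply: (@skew_poly_y_neq0 k); rewrite -hn hE g0 rmorph0 mul0r coef0.
by rewrite -horner_alg_casimir_eval -hE.
Qed.

(** Multiplying by a power of [y] rewrites [r] as a polynomial in [z], which stays nonzero since [y]
    is regular. *)
Lemma nonzero_ideal_power r : J r -> r <> 0 -> exists k, J (Y ^+ k).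
Proof.
have [_ _ JMl _] := J_ideal.
move=> Jr r0; have [k [f fE]] := ambiskew_casimir_denominator r.
apply: (@casimir_eval_power f); last by rewrite -fE; apply: JMl.
by move=> f0; apply/r0/(@ambiskew_y_reg k); rewrite fE f0 skew_eval0.
Qed.

Lemma power_ideal_full m :
    (forall m : nat, (1 <= m)%N ->
     exists p : {poly K}, p <> 0 /\
       exists a : A, horner_alg u p = orbit_sum alpha v m * a) ->
  J (Y ^+ m) -> J 1.
Proof.
have [J0 JD JMl JMr] := J_ideal.
have JB a b : J a -> J b -> J (a - b).
  by move=> Ja Jb; apply: JD => //; rewrite -mulN1r; apply: JMl.
move=> ex; elim: m => // m IH Jm; apply: IH.
have [//|p [p0 [a pa]]] := ex m.+1.
have Jv : J (aR (orbit_sum alpha v m.+1) * Y ^+ m).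
  have := x_y_power m; rewrite addrC => /eqP; rewrite -subr_eq => /eqP <-.
  by apply: JB; [apply: JMl | apply: JMr].
(* The points [u] and [-z] differ by [u + z = x y], so the two values of [p] agree up to a left
   multiple of [x y]. *)
have [|h hE] := @horner_alg_sub _ R (aR u) (- z) p.
  by rewrite mulrN mulNr casimir_central.
apply: (J_saturated (comp_polyN_neq0 p0)); rewrite -horner_algN.
have -> : horner_alg (- z) p = aR (horner_alg u p) - h * (x * Y).
  rewrite opprK [_ + z]addrC in hE.
  by rewrite !rmorph_horner_alg casimir_xy -hE subKr.
rewrite mulrBl -!mulrA -exprS; apply: JB; last by rewrite mulrA; apply: JMl.
by rewrite pa orbit_sum_central !rmorphM -mulrA; apply: JMl.
Qed.

End PowersInIdeals.

(* [R/(R c + R y^m + R x)] is a left module killed by [y^m]; it is the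
   quotient of the Verma-type module [R/R x], on whose generator [z] acts
   as [- alpha u]. *)
Definition verma_submodule (c : A) (m : nat) (t : R) : Prop :=
  exists r1 r2 r3, t = r1 * aR c + r2 * Y ^+ m + r3 * x.

Lemma verma_submoduleD c m s t :
  verma_submodule c m s -> verma_submodule c m t -> verma_submodule c m (s + t).
Proof.
move=> [s1 [s2 [s3 ->]]] [t1 [t2 [t3 ->]]]; exists (s1 + t1), (s2 + t2), (s3 + t3).
by rewrite !mulrDl addrACA; congr (_ + _); rewrite addrACA.
Qed.

Lemma verma_submoduleM c m r t :
  verma_submodule c m t -> verma_submodule c m (r * t).
Proof.
move=> [t1 [t2 [t3 ->]]]; exists (r * t1), (r * t2), (r * t3).
by rewrite !mulrDr !mulrA.
Qed.

(** Split [t] as [b + r x]: the second part falls in [R x], and [y^m b] lies in [B y^m] because [y]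
    is normal in [B]. *)
Lemma verma_submodule_power c m t : verma_submodule c m (Y ^+ m * t).
Proof.
have [b [r ->]] := left_basis_decomp outer.1 t.
have [b' bE] : exists b', y ^+ m * b = b' * y ^+ m.
  elim: m => [|m [b' IH]]; first by exists b; rewrite mulr1 mul1r.
  by have [d dE] := y_normal b'; exists d; rewrite exprS -mulrA IH mulrA dE -mulrA.
exists 0, (iB b'), (Y ^+ m * r).
by rewrite mul0r add0r mulrDr mulrA -!rmorphXn -!rmorphM bE.
Qed.

(** The choice of [c] gives [x y^(m+1) = y^(m+1) x + y^m c], so the part of [r2] divisible by [x] is
    absorbed by the other two summands. Comparing constant terms, first in [x] and then in [y],
    leaves a multiple of [c]. *)
Lemma verma_submodule_base c m a0 :
    iter m alpha c = orbit_sum alpha v m.+1 ->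
    verma_submodule c m.+1 (aR a0) ->
  exists a, a0 = a * c.
Proof.
move=> cE [r1 [r2 [r3 a0E]]].
have [b2 [r2' r2E]] := left_basis_decomp outer.1 r2.
have [b1 [r1' r1E]] := left_basis_decomp outer.1 (r1 + r2' * Y ^+ m).
have [a1 [b1' b1E]] := left_basis_decomp inner.1 b1.
have xyE : r2' * x * Y ^+ m.+1 = r2' * Y ^+ m.+1 * x + r2' * Y ^+ m * aR c.
  by rewrite -mulrA x_y_power mulrDr -cE -(mul_iter_skew ambiskew_y_comm) !mulrA.
have {}a0E : aR a0 = (r1 + r2' * Y ^+ m) * aR c + iB b2 * Y ^+ m.+1
                     + (r3 + r2' * Y ^+ m.+1) * x.
  by rewrite a0E r2E !mulrDl xyE !addrA (ACl (1*4*2*5*3)).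
have bE : iA a0 - (b1 * iA c + b2 * y ^+ m.+1) = 0.
  apply: (left_basis_decomp_eq0 outer.1
            (t := r1' * aR (alphaV c) + (r3 + r2' * Y ^+ m.+1))).
  apply/eqP; rewrite rmorphB subr_eq rmorphD !rmorphM rmorphXn /= a0E r1E.
  by rewrite !mulrDl -[r1' * x * _]mulrA ambiskew_x_comm !mulrA !addrA (ACl (2*4*5*1*3)).
have a0E' : iA (a0 - a1 * c) = (b1' * iA (alpha c) + b2 * y ^+ m) * y.
  apply/eqP; rewrite rmorphB subr_eq rmorphM mulrDl -!mulrA -(skew_poly_comm inner) /=.
  move/eqP: bE; rewrite subr_eq0 => /eqP->.
  by rewrite -exprSr b1E mulrDl !mulrA (ACl (2*3*1)).
have /eqP := left_basis_decomp_eq0 inner.1 a0E'.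
by rewrite subr_eq0 => /eqP->; exists a1.
Qed.

Lemma annihilator_casimir_poly m q :
    (1 <= m)%N ->
    verma_submodule (iter m.-1 alphaV (orbit_sum alpha v m)) m (horner_alg z q) ->
  exists a, horner_alg u (q \Po - 'X) = orbit_sum alpha v m * a.
Proof.
case: m => // m _; set c := iter _ _ _ => Nq /=.
have cE : iter m alpha c = orbit_sum alpha v m.+1 by rewrite (iter_cancel m alphaVK).
(* Since [z + alpha u = y x], the elements [q(z)] and [q(-alpha u)] agree modulo [R x]. *)
have [|h hE] := @horner_alg_sub _ R (aR (- alpha u)) z q.
  by rewrite casimir_central.
have {h hE}Nu : verma_submodule c m.+1 (aR (horner_alg (- alpha u) q)).
  rewrite !rmorph_horner_alg.
  have -> : horner_alg (aR (- alpha u)) q = horner_alg z q - h * Y * x.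
    rewrite -mulrA casimir_yx.
    move/eqP: hE; rewrite subr_eq => /eqP->.
    by rewrite !rmorphN -opprD addrC mulrN [aR _ + z]addrC.
  apply: verma_submoduleD => //; exists 0, 0, (- (h * Y)).
  by rewrite !mul0r !add0r mulNr.
have [a aE] := verma_submodule_base cE Nu.
(* These two points differ by [-v^(m+1)], so the values of [q] agree modulo [v^(m+1)]; the second is
   [alpha^m] applied to [a c]. *)
have [|h hE] := @horner_alg_sub _ A (- u) (- iter m.+1 alpha u) q.
  by rewrite !mulrNN u_central.
have iterE : horner_alg (- iter m.+1 alpha u) q = iter m alpha a * orbit_sum alpha v m.+1.
  rewrite -cE iterSr; elim: m a c (alpha u) aE {Nq cE Nu hE h} => // m IH a c w wE.
  by rewrite !iterSr; apply: IH; rewrite -rmorphN -rmorph_horner_alg wE rmorphM.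
exists (iter m alpha a - h); rewrite orbit_sum_central -horner_algN.
move/eqP: hE; rewrite subr_eq => /eqP->.
rewrite iterE mulrBl addrC orbit_sum_split; congr (_ + _).
by rewrite -mulrN opprD.
Qed.

End Ambiskew.

(** * Passage between ideals of [R] and of the localization *)

Theorem proposition2p2
  (K : closedFieldType) (A : algType K)
  (alpha : {lrmorphism A -> A}) (alphaV : A -> A)
  (alphaK : cancel alpha alphaV) (alphaVK : cancel alphaV alpha)
  (v : A) (v_central : central v)
  (B : algType K) (iA : {lrmorphism A -> B}) (y : B)
  (beta : {lrmorphism B -> B}) (delta : B -> B)
  (R : algType K) (iB : {lrmorphism B -> R}) (x : R)
  (R_ambiskew : ambiskew_ring alpha alphaV v iA y beta delta iB x)
  (u : A) (u_central : central u) (u_splits : v = u - alpha u)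
  (z : R) (z_def : z = x * iB y - iB (iA u))
  (L : algType K) (iL : {lrmorphism A -> L}) (yL yLV : L)
  (L_laurent : skew_laurent_ring alpha iL yL yLV)
  (L_simple : simple_ring L)
  (L_center : forall c : L, central c <-> exists k : K, c = k%:A)
  (RZ : pzRingType) (phi : {rmorphism R -> RZ})
  (RZ_loc : central_localization (nonzero_polynomials_in z) phi) :
  simple_ring RZ <->
  (forall m : nat, (1 <= m)%N ->
     exists p : {poly K}, p <> 0 /\
       exists a : A, horner_alg u p = orbit_sum alpha v m * a).
Proof.
pose zs := nonzero_polynomials_casimir alphaK R_ambiskew u_central u_splits z_def.
have zC := casimir_central alphaK R_ambiskew u_central u_splits z_def.
have [phi_unit phi_frac phi_ker] := RZ_loc.
split=> [[RZ1 RZ_simple] [//|m] _|ex].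
  pose c := iter m alphaV (orbit_sum alpha v m.+1).
  pose N := verma_submodule iA y iB x c m.+1.
  pose Z := nonzero_polynomials_in z.
  (* The annihilator of the left module [R / N], a two-sided ideal; [I] below is its extension to
     the localization. *)
  pose Ann r := forall t, N (r * t).
  have N0 : N 0 by exists 0, 0, 0; rewrite !mul0r !addr0.
  have Z1 : Z 1.
    by apply/zs; exists 1; rewrite ?rmorph1 //; apply/eqP/oner_neq0.
  have ZM s t : Z s -> Z t -> Z (s * t).
    move=> /zs[p p0 ->] /zs[q q0 ->]; apply/zs; exists (p * q).
      by apply/eqP; rewrite mulf_neq0 //; apply/eqP.
    by rewrite rmorphM.
  have ZC s t : Z s -> phi s * phi t = phi t * phi s.
    move=> /zs[p _ ->]; rewrite -!rmorphM; congr (phi _).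
    elim/poly_ind: p => [|p k IH]; first by rewrite rmorph0 mul0r mulr0.
    rewrite rmorphD rmorphM /= horner_algX horner_algC mulrDl mulrDr.
    by rewrite -mulrA zC !mulrA IH -scalerAl -scalerAr mul1r mulr1.
  pose I q := exists s r, [/\ Z s, Ann r & q * phi s = phi r].
  have I_ideal : two_sided_ideal I.
    split.
    - exists 1, 0; split=> [//|t|]; first by rewrite mul0r.
      by rewrite mul0r rmorph0.
    - move=> q1 q2 [s1 [r1 [Z1' A1 E1]]] [s2 [r2 [Z2 A2 E2]]].
      exists (s1 * s2), (r1 * s2 + r2 * s1); split=> [|t|]; first exact: ZM.
        by rewrite mulrDl -!mulrA; apply: verma_submoduleD; [apply: A1 | apply: A2].
      rewrite mulrDl !rmorphD !rmorphM -E1 -E2 !mulrA; congr (_ + _).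
      by rewrite -!mulrA ZC.
    - move=> q' q [s [r [Zs Ar E]]]; have [r' [s' [Zs' E']]] := phi_frac q'.
      exists (s * s'), (r' * r); split=> [|t|]; first exact: ZM.
        by rewrite -mulrA; apply: verma_submoduleM; apply: Ar.
      by rewrite !rmorphM mulrA -(mulrA q') E -E' -!mulrA -(ZC s').
    - move=> q q' [s [r [Zs Ar E]]]; have [r' [s' [Zs' E']]] := phi_frac q'.
      exists (s * s'), (r * r'); split=> [|t|]; first exact: ZM.
        by rewrite -mulrA; apply: Ar.
      by rewrite !rmorphM (ZC s) // mulrA -(mulrA q) E' -mulrA -(ZC s) // mulrA E.
  have Iy : I (phi (iB y ^+ m.+1)).
    exists 1, (iB y ^+ m.+1); split=> [//|t|]; last by rewrite rmorph1 mulr1.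
    exact: (verma_submodule_power R_ambiskew).
  have [I0|I1] := RZ_simple I I_ideal.
    (* If [I] were zero, [y^(m+1)] would be killed by a nonzero [s], against the regularity of
       [y]. *)
    have /phi_ker[s [[_ s0]]] := I0 _ Iy.
    by move/(ambiskew_y_reg alphaK R_ambiskew).
  have [s [r [Zs Ar]]] := I1 1; rewrite mul1r => E.
  (* Clearing the kernel of [phi] yields [s s' = r s'], a nonzero polynomial in [z] lying in [N]. *)
  have /phi_ker[s' [Zs']] : phi (s - r) = 0 by rewrite rmorphB E subrr.
  rewrite mulrBl => /eqP; rewrite subr_eq0 => /eqP sr.
  have /zs[q q0 qE] := ZM _ _ Zs Zs'.
  exists (q \Po - 'X); split; first exact: comp_polyN_neq0.
  apply: (annihilator_casimir_poly alphaK alphaVK R_ambiskew u_central u_splits z_def) => //.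
  by rewrite -qE sr; apply: Ar.
split.
  move=> phi1; have /phi_ker[s [[_ s0]]] : phi 1 = 0 by rewrite rmorph1.
  by rewrite mul1r.
move=> I [I0 ID IMl IMr].
have [[q [Iq q0]]|all0] := classic (exists q, I q /\ q <> 0); last first.
  by left=> q Iq; apply: NNPP => q0; apply: all0; exists q.
(* The contraction of [I] to [R] is saturated because nonzero polynomials in [z] become
   invertible. *)
right; pose J r := I (phi r).
have J_ideal : two_sided_ideal J.
  rewrite /J; split=> [|a b|r a|a r]; rewrite ?rmorph0 ?rmorphD ?rmorphM //.
  - exact: ID.
  - exact: IMl.
  - exact: IMr.
have J_saturated (g : {poly K}) r : g <> 0 -> J (horner_alg z g * r) -> J r.
  move=> g0; have [|t [_ tg]] := phi_unit (horner_alg z g); first by apply/zs; exists g.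
  by rewrite /J rmorphM => /(IMl t); rewrite mulrA tg mul1r.
have [r [s [Zs qs]]] := phi_frac q.
have Jr : J r by rewrite /J -qs; apply: IMr.
have r0 : r <> 0.
  move=> r0; apply: q0; have [t [st _]] := phi_unit s Zs.
  by rewrite -[q]mulr1 -st mulrA qs r0 rmorph0 mul0r.
have [k Jk] := nonzero_ideal_power alphaK alphaVK R_ambiskew u_central u_splits
  z_def L_laurent L_simple L_center J_ideal J_saturated Jr r0.
have := power_ideal_full alphaK alphaVK R_ambiskew u_central u_splits z_def
  J_ideal J_saturated ex Jk.
by rewrite /J rmorph1 => I1 t; rewrite -[t]mulr1; apply: IMl.
Qed.
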